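(* Let $k$ be a positive integer, and suppose $0\le p<\frac1{2k+1}$ and $\frac1{k+1}<t\le1$ with $p\le t$. Then bold play is optimal, i.e. $\pi(p,t)=1-(1-p)^m$ where $m=\lfloor 1/t\rfloor$.
   Context: Let $\beta_1,\beta_2,\ldots$ be independent Bernoulli random variables with success probability $p$. A stake sequence is a sequence $\gamma=(c_1,c_2,\ldots)$ of non-negative reals with $c_1\ge c_2\ge\cdots$ and $\sum_i c_i=1$; write $S_\gamma=\sum_i c_i\beta_i$. For $0\le p\le t\le 1$ define $\pi(p,t)=\sup\{\mathbf P(S_\gamma\ge t)\mid \gamma \text{ a stake sequence}\}$. Bold play for threshold $t$ is the stake sequence with $c_i=\frac1m$ for $i\le m$ and $c_i=0$ for $i>m$, where $m=\lfloor 1/t\rfloor$, whose success probability is $1-(1-p)^m$; bold play is optimal if it attains $\pi(p,t)$. *)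

(* Defs.v *)
From HB Require Import structures.
From mathcomp Require Import all_boot all_order all_algebra.
From mathcomp Require Import all_classical all_reals all_analysis.
Set Implicit Arguments. Unset Strict Implicit. Unset Printing Implicit Defensive.
Import Order.TTheory GRing.Theory Num.Theory.
Import numFieldNormedType.Exports.
Local Open Scope classical_set_scope.
Local Open Scope ring_scope.

Section Defs.
Context {R : realType} {d : measure_display} {T : measurableType d}.

Definition indep_seq (P : probability T R) (X : nat -> T -> R) : Prop :=
  forall (s : seq nat) (B : nat -> set R), uniq s ->
    (forall i, measurable (B i)) ->
    P (\big[setI/setT]_(i <- s) (X i @^-1` B i)) =
    (\prod_(i <- s) P (X i @^-1` B i))%E.

(* beta_1, beta_2, ... independent Bernoulli(p) (indexed from 0 here) *)
Definition bernoulli_seq (P : probability T R) (X : nat -> T -> R) (p : R) : Prop :=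
  [/\ forall i, measurable_fun setT (X i),
      forall i x, X i x = 0 \/ X i x = 1,
      forall i, P (X i @^-1` [set 1]) = p%:E
    & indep_seq P X].

Definition stake_seq (c : nat -> R) : Prop :=
  [/\ forall i, 0 <= c i, forall i, c i.+1 <= c i & series c @ \oo --> (1 : R)].

Definition stake_sum (c : nat -> R) (X : nat -> T -> R) (x : T) : R :=
  limn (series (fun i => c i * X i x)).

Definition pi_opt (P : probability T R) (X : nat -> T -> R) (t : R) : \bar R :=
  ereal_sup [set P [set x | t <= stake_sum c X x] | c in stake_seq].

End Defs.

(* Main.v *)
(* Let m = floor(1/t), so p <= 1/(2m+1) and t > 1/(m+1).  Call a set of stakes
   winning if its sum is at least t; as the stakes sum to 1, there are no m+1
   disjoint winning sets.  Following Frankl's approach to the Erdos matching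
   conjecture, single out the m+1 largest stakes c_0 >= ... >= c_m.  Bounding
   the losing probability below by the cases where at most one of them succeeds,
   it suffices that

     p * \sum_(i <= m) mu_i + (1 - p) * mu <= p * m,

   where mu (resp. mu_i) is the probability that the remaining stakes collect at
   least t (resp. t - c_i).  A shadow inequality gives
   (1 - p) * mu <= p * m * mu_m, and colouring the remaining stakes at random
   with 2m+1 colours gives \sum_(i <= m) mu_i + m * mu_m <= m.  Infinite stake
   sequences are reduced to finite ones by slightly lowering t. *)
Require Import Defs.
From HB Require Import structures.
From mathcomp Require Import all_boot all_order all_algebra.
From mathcomp Require Import all_classical all_reals all_analysis.
From mathcomp Require Import measurable_realfun ring lra zify.
Import Order.TTheory GRing.Theory Num.Theory.
Import numFieldNormedType.Exports.
Local Open Scope ring_scope.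
Set Implicit Arguments. Unset Strict Implicit. Unset Printing Implicit Defensive.

(** * Expectations over random subset sums of a finite list *)

Section SubsetSums.
Context {R : realFieldType} (p : R).

(** The expectation of [f] at the sum of a random sublist that keeps each entry independently with
    probability [p]. Conditioning on the head turns the finite argument into inductions on lists;
    [prob_weighted_sum] links it to [P]. *)
Fixpoint subset_sum_expect (s : seq R) (f : R -> R) : R :=
  if s is a :: s' then
    p * subset_sum_expect s' (fun x => f (a + x)) + (1 - p) * subset_sum_expect s' f
  else f 0.

Local Notation Ex := subset_sum_expect.
Local Notation q := (1 - p).

Lemma eq_expect (s : seq R) (f g : R -> R) : f =1 g -> Ex s f = Ex s g.
Proof.
elim: s f g => [|a s IH] f g fg /=; first exact: fg.
by rewrite (IH f g fg) (IH _ (fun x => g (a + x))) // => x; exact: fg.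
Qed.

Lemma expectD (s : seq R) (f g : R -> R) :
  Ex s (fun x => f x + g x) = Ex s f + Ex s g.
Proof. elim: s f g => [//|a s IH] f g /=; rewrite !IH; ring. Qed.

Lemma expectZ (s : seq R) (k : R) (f : R -> R) :
  Ex s (fun x => k * f x) = k * Ex s f.
Proof. elim: s f => [//|a s IH] f /=; rewrite !IH; ring. Qed.

Lemma expect_cst (s : seq R) (k : R) : Ex s (fun=> k) = k.
Proof. elim: s => [//|a s IH] /=; rewrite !IH; ring. Qed.

Lemma expect_sum (I : Type) (r : seq I) (s : seq R) (f : I -> R -> R) :
  Ex s (fun x => \sum_(i <- r) f i x) = \sum_(i <- r) Ex s (f i).
Proof.
elim: r => [|i r IH].
  by rewrite big_nil -[RHS](expect_cst s); apply: eq_expect => x; rewrite big_nil.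
rewrite big_cons -IH -expectD.
by apply: eq_expect => x; rewrite big_cons.
Qed.

Hypothesis (p0 : 0 <= p) (p1 : p <= 1).
Let q0 : 0 <= q. Proof. by rewrite subr_ge0. Qed.

Lemma le_expect (s : seq R) (f g : R -> R) :
  (forall a, a \in s -> 0 <= a) -> (forall x, 0 <= x -> f x <= g x) ->
  Ex s f <= Ex s g.
Proof.
elim: s f g => [|a s IH] f g s0 fg /=; first exact: fg.
have a0 : 0 <= a by apply: s0; rewrite mem_head.
have s'0 b : b \in s -> 0 <= b by move=> bs; apply: s0; rewrite inE bs orbT.
apply: lerD; apply: ler_wpM2l => //; apply: IH => // x x0; apply: fg => //.
exact: addr_ge0.
Qed.

(* Only the random sets that meet [h] in at most one point are counted on the
   left; the factor [1 - p] avoids the exponent [size h - 1]. *)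
Lemma expect_cat_ge (h r : seq R) (g : R -> R) :
  (forall a, a \in h ++ r -> 0 <= a) -> (forall x, 0 <= g x) ->
  q ^+ size h * (q * Ex r g + p * \sum_(a <- h) Ex r (fun x => g (a + x)))
  <= q * Ex (h ++ r) g.
Proof.
elim: h g => [|a h IH] g s0 g0 /=.
  by rewrite big_nil mulr0 addr0 expr0 mul1r.
have s'0 b : b \in h ++ r -> 0 <= b by move=> bs; apply: s0; rewrite inE bs orbT.
(* Count only the outcome in which no entry of [h] is kept. *)
have empty_ge f : (forall x, 0 <= f x) -> q ^+ size h * Ex r f <= Ex (h ++ r) f.
  elim: (h) s'0 f => [|b l IHl] l0 f f0 /=; first by rewrite mul1r.
  have l'0 c : c \in l ++ r -> 0 <= c by move=> cl; apply: l0; rewrite inE cl orbT.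
  rewrite exprS -mulrA -[leLHS]add0r; apply: lerD.
    apply: mulr_ge0 => //; rewrite -(expect_cst (l ++ r) 0).
    exact: le_expect.
  by apply: ler_wpM2l => //; apply: IHl.
(* If the head [a] is kept, the rest of [h] must be avoided ([A1]); if it is dropped, induction
   applies ([A2]). *)
have A1 := empty_ge (fun x => g (a + x)) (fun x => g0 _).
have A2 := ler_wpM2l q0 (IH g s'0 g0).
have A3 := ler_wpM2l (mulr_ge0 q0 p0) A1.
rewrite big_cons exprS.
move: A2 A3; set u := q ^+ size h; set S := \sum_(_ <- _) _; set E1 := Ex _ _.
set E2 := Ex _ _; set E3 := Ex _ _; set E4 := Ex _ _.
set w := q => A2 A3; lra.
Qed.

(* Moving one point out of the random set costs the odds [p / (1 - p)] and
   lowers its sum by at most [c]; weighting the points by their stakes makes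
   the two sides comparable. *)
Lemma expect_shadow (s : seq R) (c : R) (f : R -> R) :
  (forall a, a \in s -> 0 <= a <= c) -> {homo f : x y / x <= y} ->
  q * Ex s (fun x => x * f x)
  <= p * Ex s (fun x => (\sum_(a <- s) a - x) * f (x + c)).
Proof.
elim: s f => [|a s IH] f s0 fm.
  by rewrite /= big_nil subrr !mul0r !mulr0.
have /andP[a0 ac] : 0 <= a <= c by apply: s0; rewrite mem_head.
have s'0 b : b \in s -> 0 <= b <= c by move=> bs; apply: s0; rewrite inE bs orbT.
have I1 := IH f s'0 fm.
have I2 : q * Ex s (fun x => x * f (a + x)) <=
    p * Ex s (fun x => (\sum_(a <- s) a - x) * f (a + x + c)).
  rewrite [X in p * X](_ : _ =
     Ex s (fun x => (\sum_(a <- s) a - x) * f (a + (x + c)))).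
    apply: (IH (fun x => f (a + x)) s'0) => x y xy; apply: fm.
    by rewrite lerD2l.
  by apply: eq_expect => x; rewrite addrA.
(* The exchange for the head itself: removing [a] from the set is offset by the shift [c], since
   [a <= c]. *)
have I3 : Ex s (fun x => f (a + x)) <= Ex s (fun x => f (x + c)).
  apply: le_expect => [b /s'0/andP[]//|x x0]; apply: fm.
  by rewrite addrC lerD2l.
rewrite /= big_cons.
rewrite (@eq_expect _ (fun x => (a + x) * f (a + x))
  (fun x => a * f (a + x) + x * f (a + x))); last by move=> x; ring.
rewrite (@eq_expect _ (fun x => (a + \sum_(j <- s) j - (a + x)) * f (a + x + c))
  (fun x => (\sum_(j <- s) j - x) * f (a + x + c))); last by move=> x; ring.
rewrite (@eq_expect _ (fun x => (a + \sum_(j <- s) j - x) * f (x + c))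
  (fun x => a * f (x + c) + (\sum_(j <- s) j - x) * f (x + c))); last first.
  by move=> x; ring.
rewrite !expectD !expectZ.
have J1 := ler_wpM2l q0 I1; have J2 := ler_wpM2l p0 I2.
have J3 := ler_wpM2l (mulr_ge0 (mulr_ge0 p0 q0) a0) I3.
move: J1 J2 J3; set E1 := Ex _ _; set E2 := Ex _ _; set E3 := Ex _ _.
set E4 := Ex _ _; set E5 := Ex _ _; set E6 := Ex _ _; set w := q => *; lra.
Qed.

(* Give every point at most one of [N] colours, each with probability [p]: the
   colour classes are disjoint, and each is distributed as the random set. *)
Lemma expect_coloring (N : nat) (s : seq R) (phi : 'I_N -> R -> R) (K : R) :
  N%:R * p <= 1 -> (forall a, a \in s -> 0 <= a) ->
  (forall y : 'I_N -> R, (forall j, 0 <= y j) ->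
     \sum_j y j <= \sum_(a <- s) a -> \sum_j phi j (y j) <= K) ->
  \sum_j Ex s (phi j) <= K.
Proof.
move=> Np; elim: s phi => [|a s IH] phi s0 HK /=.
  by apply: (HK (fun=> 0)) => //; rewrite big_nil sumr_const mul0rn.
have a0 : 0 <= a by apply: s0; rewrite mem_head.
have s'0 b : b \in s -> 0 <= b by move=> bs; apply: s0; rewrite inE bs orbT.
(* The payoffs once the head has received colour [l]. *)
pose psi l j x := phi j ((if j == l then a else 0) + x).
have B0 : \sum_j Ex s (phi j) <= K.
  apply: IH => // y y0 ys; apply: HK => //; rewrite big_cons.
  by rewrite -[leLHS]add0r lerD.
have Bl l : \sum_j Ex s (psi l j) <= K.
  apply: IH => // y y0 ys.
  apply: (HK (fun j => (if j == l then a else 0) + y j)) => [j|].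
    by rewrite addr_ge0 //; case: ifP.
  by rewrite big_split /= -big_mkcond big_pred1_eq big_cons lerD2l.
(* Average over the colour of the head: each [l] has weight [p], and no colour has weight
   [1 - N * p]. *)
have Bs : p * (\sum_l \sum_j Ex s (psi l j)) <= p * (N%:R * K).
  apply: ler_wpM2l => //; rewrite mulr_natl -[in leRHS](card_ord N) -sumr_const.
  exact: ler_sum.
have B0' : (1 - N%:R * p) * (\sum_j Ex s (phi j)) <= (1 - N%:R * p) * K.
  by rewrite ler_wpM2l // subr_ge0.
(* For a fixed class [j], one colour [l] adds the head to it and the other [N - 1] leave it
   unchanged. *)
suff E : \sum_l \sum_j Ex s (psi l j) =
    \sum_j Ex s (fun x => phi j (a + x)) + (N%:R - 1) * \sum_j Ex s (phi j).
  rewrite big_split /= -!mulr_sumr.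
  rewrite E in Bs; move: Bs B0'; set A := \sum_j _; set B := \sum_j _.
  set M : R := N%:R; lra.
rewrite exchange_big /= mulr_sumr -big_split; apply: eq_bigr => j _.
rewrite (bigD1 j) //=; congr (_ + _).
  by apply: eq_expect => x; rewrite /psi eqxx.
rewrite (eq_bigr (fun=> Ex s (phi j))).
  rewrite sumr_const cardC1 card_ord -[LHS]mulr_natl; congr (_ * _).
  by case: (N) j => [[]//|n] _; rewrite -[n.+1]addn1 natrD addrK addn1.
by move=> l lj; apply: eq_expect => x; rewrite /psi eq_sym (negbTE lj) add0r.
Qed.

End SubsetSums.

(** * A counting bound for thresholds reached by disjoint classes *)

Section Thresholds.
Context {R : realFieldType}.

(* Sort [y] decreasingly; if [tau (m - u) <= y_u] held for all [u <= m], the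
   entries of [y] would sum to at least the thresholds. *)
Lemma sum_thresholds_le (m : nat) (tau : nat -> R) (y : seq R) :
  size y = (2 * m + 1)%N -> (forall x, x \in y -> 0 <= x) ->
  (forall i j, (i <= j)%N -> tau i <= tau j) ->
  \sum_(x <- y) x < \sum_(0 <= i < m.+1) tau i ->
  (\sum_(x <- y) (\sum_(0 <= i < m.+1) (tau i <= x)%R + m * (tau m <= x)%R)
   <= m * (2 * m + 1))%N.
Proof.
move=> sy y0 taum; set ys := sort >=%O y.
have yys : perm_eq y ys by rewrite perm_sym perm_sort.
have sys : size ys = (2 * m + 1)%N by rewrite size_sort.
have ys0 j : 0 <= nth 0 ys j.
  have [js|js] := ltnP j (size ys); last by rewrite nth_default.
  by apply: y0; rewrite (perm_mem yys) mem_nth.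
have sorted_ys : sorted >=%O ys by apply: sort_sorted => a b; apply: le_total.
have ge_tr : transitive (>=%O : rel R) by move=> a b c ab bc; apply: le_trans bc ab.
have ge_refl : reflexive (>=%O : rel R) by move=> a; apply: lexx.
rewrite !(perm_big _ yys) /= => ylt.
have [u um yu] : exists2 u, (u <= m)%N & nth 0 ys u < tau (m - u)%N.
  have [/existsP[u yu]|/existsPn Nyu] :=
    boolP [exists u : 'I_m.+1, nth 0 ys u < tau (m - u)%N].
    by exists u => //; rewrite -ltnS.
  suff : \sum_(0 <= i < m.+1) tau i <= \sum_(x <- ys) x by rewrite leNgt ylt.
  (* Pair the [m + 1] largest entries with the thresholds in reverse order; the other [m] entries
     are nonnegative. *)
  rewrite big_nat_rev [leRHS](big_nth 0) sys.
  rewrite [leRHS](@big_cat_nat _ _ _ m.+1) //=; last by lia.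
  rewrite -[leLHS]addr0; apply: lerD; last by apply: sumr_ge0.
  apply: ler_sum_nat => i /andP[_ im]; rewrite leNgt add0n subSS.
  exact: (Nyu (Ordinal im)).
have bound_ge x : (\sum_(0 <= i < m.+1) (tau i <= x)%R + m * (tau m <= x)%R
    <= 2 * m + 1)%N.
  have -> : (2 * m + 1 = \sum_(0 <= i < m.+1) 1 + m * 1)%N.
    by rewrite sum_nat_const_nat; lia.
  by rewrite leq_add ?leq_mul ?leq_b1 //; apply: leq_sum => i _; exact: leq_b1.
(* An entry below [tau (m - u)] reaches only thresholds of index less than [m - u], hence not
   [tau m]. *)
have bound_lt x : x < tau (m - u)%N ->
    (\sum_(0 <= i < m.+1) (tau i <= x)%R + m * (tau m <= x)%R <= m - u)%N.
  move=> xu; have Nle i : (m - u <= i)%N -> (tau i <= x)%R = false.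
    by move=> ui; apply/negbTE; rewrite -ltNge; apply: lt_le_trans (taum _ _ ui).
  rewrite Nle ?leq_subr// muln0 addn0 (@big_cat_nat _ _ _ (m - u)) //=; last by lia.
  rewrite [X in (_ + X)%N]big_nat_cond [X in (_ + X)%N]big1 ?addn0; last first.
    by move=> i; rewrite andbT => /andP[/Nle ->].
  rewrite -[leqRHS]subn0 -[leqRHS]muln1 -sum_nat_const_nat.
  by apply: leq_sum => i _; exact: leq_b1.
rewrite (big_nth 0) sys (@big_cat_nat _ _ _ u) //=; last by lia.
set F := fun x => (\sum_(0 <= i < m.+1) (tau i <= x)%R + m * (tau m <= x)%R)%N.
have head_le : (\sum_(0 <= j < u) F (nth 0%R ys j) <= u * (2 * m + 1))%N.
  rewrite -[X in (_ <= X * _)%N]subn0 -sum_nat_const_nat.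
  by apply: leq_sum => j _; apply: bound_ge.
have tail_le : (\sum_(u <= j < 2 * m + 1) F (nth 0%R ys j)
    <= (2 * m + 1 - u) * (m - u))%N.
  rewrite -sum_nat_const_nat big_nat_cond [leqRHS]big_nat_cond.
  apply: leq_sum => j /andP[/andP[uj jm] _]; apply: bound_lt.
  apply: le_lt_trans yu.
  by apply: (sorted_leq_nth ge_tr ge_refl 0 sorted_ys) => //; rewrite inE sys; lia.
(* The two bounds add up to [m * (2 * m + 1) - u * (m - u)]. *)
by apply: leq_trans (leq_add head_le tail_le) _; nia.
Qed.

End Thresholds.

(** * The upper bound for finitely many stakes *)

Section Finite.
Context {R : realFieldType} (p : R).
Local Notation Ex := (subset_sum_expect p).
Local Notation q := (1 - p).

(** The stakes need only sum to at most 1, so that truncations of a stake sequence qualify. *)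
Lemma expect_threshold_le (m n : nat) (c : nat -> R) (t : R) :
  0 <= p -> p < 1 -> (2 * m + 1)%:R * p <= 1 ->
  (forall i, 0 <= c i) -> (forall i j, (i <= j)%N -> c j <= c i) ->
  \sum_(0 <= i < m.+1 + n) c i <= 1 -> 1 < m.+1%:R * t -> 
  Ex [seq c i | i <- iota 0 (m.+1 + n)] (fun x => (t <= x)%R%:R) <= 1 - q ^+ m.
Proof.
move=> p0 p1 mp c0 cm sum1 t1.
have q0 : 0 < q by rewrite subr_gt0.
have t0 : 0 < t by rewrite -(pmulr_rgt0 _ (ltr0Sn R m)) (lt_trans ltr01).
rewrite iotaD map_cat add0n.
set h := map c _; set r := map c _; set f := fun x : R => (t <= x)%R%:R : R.
have sz_h : size h = m.+1 by rewrite size_map size_iota.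
have sum_h (F : R -> R) : \sum_(a <- h) F a = \sum_(0 <= i < m.+1) F (c i).
  by rewrite big_map.
have sum_hr : \sum_(a <- h) a + \sum_(a <- r) a <= 1.
  by rewrite -big_cat -map_cat -{2}[m.+1]add0n -iotaD big_map.
have r_le a : a \in r -> 0 <= a <= c m.
  by case/mapP => i; rewrite mem_iota => /andP[mi _] ->; rewrite c0 cm // ltnW.
have hr0 a : a \in h ++ r -> 0 <= a.
  by rewrite /h /r -map_cat => /mapP[i _ ->].
have cm_le : c m <= \sum_(a <- h) a.
  by rewrite sum_h big_nat_recr //= lerDr sumr_ge0.
have f01 x : 0 <= f x <= 1 by rewrite /f; case: (t <= x); rewrite ?lexx ?ler01.
pose mu a := Ex r (fun x => f (a + x)).
have shadow : q * Ex r f <= p * (m%:R * mu (c m)).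
  have fm : {homo f : x y / x <= y}.
    move=> x y xy; rewrite /f; have [tx|_] := leP t x.
      by rewrite (le_trans tx xy).
    by case: (t <= y); rewrite ?ler01.
  (* The factor [t] allows [t * f x <= x * f x], which brings in the stake weights of
     [expect_shadow]. *)
  rewrite -(ler_pM2l t0).
  have -> : t * (q * Ex r f) = q * Ex r (fun x => t * f x) by rewrite expectZ; ring.
  have r0 b : b \in r -> 0 <= b by case/r_le/andP.
  apply: (@le_trans _ _ (q * Ex r (fun x => x * f x))).
    rewrite ler_pM2l //; apply: le_expect => //; first exact: ltW.
    by move=> x x0; rewrite /f; case: (leP t x) => tx; rewrite ?mulr1 ?mulr0.
  apply: (le_trans (expect_shadow p0 (ltW p1) r_le fm)).
  rewrite mulrCA; apply: ler_wpM2l => //.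
  rewrite mulrA -expectZ; apply: le_expect => //; first exact: ltW.
  move=> x x0; rewrite /f [x + _]addrC.
  case: (leP t (c m + x)) => tx; last by rewrite !mulr0.
  (* With [S] and [H] the sums of [r] and [h]: [S - x <= (1 - H) - (t - c m) <= 1 - t < m * t], as
     [c m <= H]. *)
  move: t1 sum_hr cm_le; rewrite !mulr1 -natr1.
  by set M : R := m%:R; set S := \sum_(a <- r) a; set H := \sum_(a <- h) a => *; nra.
have colors : \sum_(a <- h) mu a + m%:R * mu (c m) <= m%:R.
  pose phi x := \sum_(a <- h) f (a + x) + m%:R * f (c m + x).
  have -> : \sum_(a <- h) mu a + m%:R * mu (c m) = Ex r phi.
    by rewrite expectD expectZ expect_sum.
  have N0 : 0 < (2 * m + 1)%:R :> R by rewrite ltr0n addn1.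
  (* All [2 * m + 1] colour classes have the same law, so their total payoff is [2 * m + 1] times
     one expectation. *)
  rewrite -(ler_pM2l N0) mulr_natl -[in leLHS](card_ord (2 * m + 1)) -sumr_const.
  apply: (@expect_coloring _ _ p0 _ r (fun=> phi)) => // [a /r_le/andP[] //|y y0 ys].
  pose Y := [seq y j | j <- index_enum 'I_(2 * m + 1)].
  have phiE x : phi x =
      (\sum_(0 <= i < m.+1) (t - c i <= x)%R + m * (t - c m <= x)%R)%N%:R.
    rewrite natrD natrM natr_sum /phi sum_h /f.
    by congr (_ + _ * _); [apply: eq_bigr => i _|]; rewrite lerBlDl.
  under eq_bigr do rewrite phiE.
  rewrite -natr_sum mulrC -natrM ler_nat.
  rewrite -(big_map y xpredT (fun x => \sum_(0 <= i < m.+1) (t - c i <= x)%R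
     + m * (t - c m <= x)%R)%N) -/Y.
  apply: (@sum_thresholds_le _ m (fun i => t - c i)).
  - by rewrite size_map -[RHS]card_ord cardE enumT.
  - by move=> _ /mapP[j _ ->].
  - by move=> i j ij; rewrite lerD2l lerN2 cm.
  (* The thresholds [t - c i] sum to [(m + 1) * t - H > 1 - H], with [H] the sum of [h], which
     exceeds what [r] can supply. *)
  - rewrite big_map; apply: (le_lt_trans ys).
    rewrite sumrB sumr_const_nat subn0 ltrBrDl -(sum_h id) -[t *+ _]mulr_natl.
    exact: le_lt_trans sum_hr t1.
have g0 x : 0 <= 1 - f x by case/andP: (f01 x); lra.
have Ex_compl s g : Ex s (fun x => 1 - g x) = 1 - Ex s g.
  have := expectD p s (fun=> 1) (fun x => -1 * g x).
  rewrite expectZ expect_cst mulN1r => <-; apply: eq_expect => x; ring.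
(* Apply the bound to the indicator [1 - f] of losing, then cancel one factor [1 - p]. *)
have := expect_cat_ge p0 (ltW p1) hr0 g0.
rewrite !Ex_compl; under eq_bigr do rewrite Ex_compl.
rewrite sumrB big_const_seq count_predT sz_h iter_addr_0.
rewrite -/(mu _) exprS -mulrA ler_pM2l //.
move=> compl_ge; rewrite lerBrDl -lerBrDr; apply: le_trans compl_ge.
rewrite -[leLHS]mulr1; apply: ler_wpM2l; first by rewrite exprn_ge0 // ltW.
(* What remains, [p * S + (1 - p) * G <= p * m], is [p] times [colors] combined with [shadow]. *)
move: (ler_wpM2l p0 colors) shadow; rewrite /mu.
set S := \sum_(a <- h) _; set G := Ex r f; set M := Ex r _.
rewrite -natr1; set k : R := m%:R => *; lra.
Qed.
End Finite.

(** * From the probability space to subset sums, and from infinite to finite sums *)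

Section Bernoulli.
Local Open Scope classical_set_scope.
Context {R : realType} {d : measure_display} {T : measurableType d}.
Context {P : probability T R} {X : nat -> T -> R} {p : R}.
Hypothesis bX : bernoulli_seq P X p.

Lemma measurable_weighted_sum (c : nat -> R) (s : seq nat) :
  measurable_fun setT (fun x => \sum_(i <- s) c i * X i x).
Proof.
have [mX _ _ _] := bX.
by apply: measurable_sum => i; apply: measurable_funM => //.
Qed.

Lemma measurable_ge (f : T -> R) (t : R) :
  measurable_fun setT f -> measurable [set x | t <= f x].
Proof.
move=> mf; have := mf measurableT `[t, +oo[ (measurable_itv _).
rewrite setTI; congr (measurable _).
by apply/seteqP; split => x /=; rewrite in_itv /= andbT.
Qed.

Lemma measurable_value (i : nat) (v : R) : measurable (X i @^-1` [set v]).
Proof.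
have [mX _ _ _] := bX.
by rewrite -[X in measurable X]setTI; apply: mX => //; exact: measurable_set1.
Qed.

Lemma prob_value0 (i : nat) : P (X i @^-1` [set 0]) = (1 - p)%:E.
Proof.
have [_ X01 X1 _] := bX.
rewrite (_ : X i @^-1` [set 0] = ~` (X i @^-1` [set 1])).
  by rewrite probability_setC ?X1 //; exact: measurable_value.
apply/seteqP; split => x /=; first by move=> ->; apply/eqP; rewrite eq_sym oner_eq0.
by case: (X01 i x).
Qed.

Lemma prob_values_cons (i : nat) (s : seq nat) (b : nat -> R) : uniq (i :: s) ->
  P (X i @^-1` [set b i] `&` \big[setI/setT]_(j <- s) (X j @^-1` [set b j])) =
  (P (X i @^-1` [set b i]) * P (\big[setI/setT]_(j <- s) (X j @^-1` [set b j])))%E.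
Proof.
have [_ _ _ indX] := bX => uis; have us : uniq s by case/andP: uis.
have mb j : measurable [set b j] by exact: measurable_set1.
rewrite (indX s (fun j => [set b j])) //.
by have := indX (i :: s) (fun j => [set b j]) uis mb; rewrite !big_cons.
Qed.

(** Prescribing the values on [s1] makes the induction work: each step fixes one more variable at 0
    or 1 and moves its index from [s2] to [s1]. *)
Lemma prob_weighted_sum_cond (c b : nat -> R) (s1 s2 : seq nat) (t : R) :
  uniq (s1 ++ s2) ->
  P (\big[setI/setT]_(i <- s1) (X i @^-1` [set b i]) `&`
     [set x | t <= \sum_(i <- s2) c i * X i x]) =
  (P (\big[setI/setT]_(i <- s1) (X i @^-1` [set b i])) *
   (subset_sum_expect p (map c s2) (fun x => (t <= x)%R%:R))%:E)%E.
Proof.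
have [_ X01 X1 _] := bX.
elim: s2 s1 b t => [|i s2 IH] s1 b t us.
  under eq_set => x do rewrite big_nil.
  rewrite /=; case: (t <= 0).
    by rewrite mule1 (_ : [set _ | _] = setT) ?setIT //; apply/seteqP; split.
  by rewrite mule0 (_ : [set _ | _] = set0) ?setI0 ?measure0 //; apply/seteqP; split.
have us' : uniq ((i :: s1) ++ s2) by move: us; rewrite -cat1s uniq_catCA.
have is1 : i \notin s1 by move: us'; rewrite /= mem_cat negb_or => /andP[/andP[]].
have uis1 : uniq (i :: s1) by move: us'; rewrite cat_uniq => /andP[].
pose A := \big[setI/setT]_(j <- s1) (X j @^-1` [set b j]).
(* Overwriting [b] at [i] leaves the event [A] unchanged, because [i] is not in [s1]. *)
pose bv v j : R := if j == i then v else b j.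
have bvE v : \big[setI/setT]_(j <- s1) (X j @^-1` [set bv v j]) = A.
  rewrite /A big_seq [RHS]big_seq; apply: eq_bigr => j js1; rewrite /bv.
  by case: eqP => // ji; rewrite -ji js1 in is1.
have bvi v : bv v i = v by rewrite /bv eqxx.
have split_value (v t' : R) :
    P ((X i @^-1` [set v] `&` A) `&` [set x | t' <= \sum_(j <- s2) c j * X j x]) =
    (P (X i @^-1` [set v]) * P A *
      (subset_sum_expect p (map c s2) (fun x => (t' <= x)%R%:R))%:E)%E.
  have := IH (i :: s1) (bv v) t' us'.
  by rewrite big_cons prob_values_cons // bvE bvi.
have mA : measurable A.
  by apply: bigsetI_measurable => j _; exact: measurable_value.
(* Split on the value of [X i]: a success lowers the threshold by [c i], a failure keeps it. *)
pose B (v t' : R) :=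
  (X i @^-1` [set v] `&` A) `&` [set x | t' <= \sum_(j <- s2) c j * X j x].
have mB v t' : measurable (B v t').
  apply: measurableI; first by apply: measurableI => //; exact: measurable_value.
  by apply: measurable_ge; exact: measurable_weighted_sum.
have B10 : B 1 (t - c i) `&` B 0 t = set0.
  apply/seteqP; split => x //= -[[[Xi1 _] _] [[Xi0 _] _]].
  by move/eqP: (etrans (esym Xi1) Xi0); rewrite oner_eq0.
have PB : P (B 1%R (t - c i)%R `|` B 0%R t) =
    (P (B 1%R (t - c i)%R) + P (B 0%R t))%E.
  exact: measureU.
rewrite -/A (_ : A `&` _ = B 1 (t - c i) `|` B 0 t).
  rewrite PB !split_value X1 prob_value0 /=.
  rewrite (@eq_expect _ _ _ (fun x => (t <= c i + x)%R%:R)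
    (fun x => (t - c i <= x)%R%:R)); last by move=> x; rewrite lerBlDl.
  by rewrite -(fineK (fin_num_measure P _ mA)) -!EFinM -EFinD; congr (_%:E); ring.
apply/seteqP; split => x /=; rewrite big_cons.
  case=> Ax; case: (X01 i x) => Xi; rewrite Xi.
    by rewrite mulr0 add0r; right.
  by rewrite mulr1 -lerBlDl; left.
case=> -[[/= Xi Ax] /= le_sum]; split=> //; rewrite Xi ?mulr0 ?add0r //.
by rewrite mulr1 -lerBlDl.
Qed.

Lemma prob_weighted_sum (c : nat -> R) (n : nat) (t : R) :
  P [set x | t <= \sum_(0 <= i < n) c i * X i x] =
  (subset_sum_expect p [seq c i | i <- iota 0 n] (fun x => (t <= x)%R%:R))%:E.
Proof.
have := @prob_weighted_sum_cond c (fun=> 0) [::] (iota 0 n) t.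
by rewrite big_nil setTI probability_setT mul1e iota_uniq /index_iota subn0 => ->.
Qed.

Lemma partial_sums_cvg (c : nat -> R) (x : T) : stake_seq c ->
  nondecreasing_seq (series (fun i => c i * X i x)) /\
  cvgn (series (fun i => c i * X i x)).
Proof.
move=> [c0 _ c1]; have [_ X01 _ _] := bX.
have cX i : 0 <= c i * X i x <= c i.
  by case: (X01 i x) => ->; rewrite ?mulr0 ?mulr1 ?lexx ?c0.
split.
  by apply: nondecreasing_series => i _ _; case/andP: (cX i).
apply: (@series_le_cvg _ _ c) => //; first by move=> i; case/andP: (cX i).
  by move=> i; case/andP: (cX i).
by apply/cvg_ex; exists 1.
Qed.

Lemma measurable_stake_sum (c : nat -> R) : stake_seq c ->
  measurable_fun setT (stake_sum c X).
Proof.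
move=> cs; apply: (@measurable_fun_cvg _ _ _ _
  (fun n x => series (fun i => c i * X i x) n)) => [n|x _].
  by rewrite /series; exact: measurable_weighted_sum.
exact: (partial_sums_cvg x cs).2.
Qed.

(** A limit that is at least [t] may have all partial sums below [t], but some partial sum passes
    [t' < t]. The events for [t'] increase with [n], so continuity from below applies. *)
Lemma prob_stake_sum_le (c : nat -> R) (t t' : R) (N : nat) (K : \bar R) :
  stake_seq c -> t' < t ->
  (forall n, (N <= n)%N ->
     (P [set x | (t' <= \sum_(0 <= i < n) c i * X i x)%R] <= K)%E) ->
  (P [set x | (t <= stake_sum c X x)%R] <= K)%E.
Proof.
move=> cs tt HK.
pose F n := [set x | t' <= \sum_(0 <= i < N + n) c i * X i x].
have mF n : measurable (F n) by apply: measurable_ge; exact: measurable_weighted_sum.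
have mUF : measurable (\bigcup_n F n) by exact: bigcupT_measurable.
have Fhomo : {homo F : n m / (n <= m)%N >-> (n <= m)%O}.
  move=> n m nm; apply/subsetPset => x /= /le_trans; apply.
  by apply: (partial_sums_cvg x cs).1; rewrite leq_add2l.
have PF := nondecreasing_cvg_mu mF mUF Fhomo (mu := P).
apply: (@le_trans _ _ (P (\bigcup_n F n))).
  apply: le_measure; rewrite ?inE //.
    by apply: measurable_ge; exact: measurable_stake_sum.
  move=> x /= tx; have [nd cv] := partial_sums_cvg x cs.
  have [n _ Hn] := lt_lim nd cv (lt_le_trans tt tx).
  by exists n => //; apply: (Hn (N + n)%N); rewrite /= leq_addl.
rewrite -(cvg_lim _ PF) //; apply: lime_le; first by apply/cvg_ex; eexists; exact: PF.
by apply: nearW => n; apply: HK; rewrite leq_addr.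
Qed.

End Bernoulli.

(** * The lower bound from bold play *)

Section BoldPlay.
Local Open Scope classical_set_scope.
Context {R : realType}.

Lemma series_finite_support (u : nat -> R) (m : nat) :
  (forall i, (m <= i)%N -> u i = 0) ->
  series u @ \oo --> \sum_(0 <= i < m) u i.
Proof.
move=> u0; apply: cvg_near_cst; exists m => // n /= mn.
rewrite /series /= (@big_cat_nat _ _ _ m) //=.
by rewrite [X in _ + X]big_nat_cond [X in _ + X]big1 ?addr0 // => i /andP[/andP[/u0]].
Qed.

Definition bold_play (m i : nat) : R := if (i < m)%N then m%:R^-1 else 0.

Lemma bold_play_stake_seq (m : nat) : (0 < m)%N -> stake_seq (bold_play m).
Proof.
move=> m0; split=> [i|i|]; rewrite /bold_play.
- by case: ifP => // _; rewrite invr_ge0.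
- case: (ltnP i m) => im; last by rewrite ltnNge (leq_trans im).
  by case: ifP => // _; rewrite invr_ge0.
- rewrite [X in _ --> X](_ : 1 = \sum_(0 <= i < m) bold_play m i).
    by apply: series_finite_support => i mi; rewrite /bold_play ltnNge mi.
  rewrite (eq_big_nat _ _ (F2 := fun=> m%:R^-1)) => [|i /andP[_ im]]; last first.
    by rewrite /bold_play im.
  by rewrite sumr_const_nat subn0 -[_^-1 *+ _]mulr_natl divff // pnatr_eq0 -lt0n.
Qed.

(** A single success among the first [m] variables already pays [1 / m >= t], so losing requires all
    of them to vanish. *)
Lemma prob_bold_play_ge {d : measure_display} {T : measurableType d}
  {P : probability T R} {X : nat -> T -> R} {p : R} (bX : bernoulli_seq P X p)
  (m : nat) (t : R) : (0 < m)%N -> t <= m%:R^-1 ->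
  ((1 - (1 - p) ^+ m)%:E <= P [set x | (t <= stake_sum (bold_play m) X x)%R])%E.
Proof.
move=> m0 tm; have [_ X01 _ indX] := bX.
have stake := bold_play_stake_seq m0.
pose A := \big[setI/setT]_(i <- iota 0 m) (X i @^-1` [set 0]).
have mA : measurable A.
  by apply: bigsetI_measurable => i _; exact: (measurable_value bX).
have PA : P A = ((1 - p) ^+ m)%:E.
  rewrite (indX (iota 0 m) (fun=> [set 0])) ?iota_uniq //.
  under eq_bigr do rewrite (prob_value0 bX).
  by rewrite prodEFin big_const_seq count_predT size_iota iter_mulr_1.
rewrite EFinB -PA -probability_setC //; apply: le_measure; rewrite ?inE.
- exact: measurableC.
- by apply: measurable_ge; exact: (measurable_stake_sum bX).
move=> x; rewrite /A -bigcap_seq => /= NAx; apply: (le_trans tm).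
have X_ge0 i : 0 <= bold_play m i * X i x.
  by have [c0 _ _] := stake; case: (X01 i x) => ->; rewrite ?mulr0 ?mulr1.
have /existsNP[i /not_implyP[im Xi]] := NAx.
have {}im : (i < m)%N by move: im; rewrite /= mem_iota.
have -> : stake_sum (bold_play m) X x = \sum_(0 <= i < m) bold_play m i * X i x.
  apply/cvg_lim => //; apply: series_finite_support => j mj.
  by rewrite /bold_play ltnNge mj mul0r.
have Xi1 : X i x = 1 by case: (X01 i x).
rewrite (bigD1_seq i) ?mem_index_iota ?iota_uniq //= Xi1 mulr1 {1}/bold_play im.
by rewrite lerDl sumr_ge0.
Qed.

End BoldPlay.

(** * The upper bound for every stake sequence, and optimality of bold play *)

Lemma prob_stake_sum_bound (R : realType) (d : measure_display)
  (T : measurableType d) (P : probability T R) (X : nat -> T -> R) (p t : R)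
  (m : nat) (c : nat -> R) :
  bernoulli_seq P X p -> 0 <= p -> p < 1 -> (2 * m + 1)%:R * p <= 1 ->
  1 < m.+1%:R * t -> stake_seq c ->
  (P [set x | (t <= stake_sum c X x)%R]%classic <= (1 - (1 - p) ^+ m)%:E)%E.
Proof.
move=> bX p0 p1 mp mt cs; have [c0 cS c1] := cs.
have m0 : 0 < m.+1%:R :> R by rewrite ltr0n.
(* The midpoint of [1 / (m + 1)] and [t]: below [t], yet still with [1 < (m + 1) * t']. *)
pose t' := (m.+1%:R^-1 + t) / 2.
have mt1 : m.+1%:R^-1 < t by rewrite -(ltr_pM2l m0) divff ?gt_eqF.
have mt' : 1 < m.+1%:R * t'.
  by rewrite /t' mulrA mulrDr divff ?gt_eqF //; lra.
(* Taking [N = m + 1] keeps the [m + 1] largest stakes in every truncation. *)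
apply: (prob_stake_sum_le bX (t' := t') (N := m.+1) cs); first by rewrite midf_lt.
move=> n mn; rewrite (prob_weighted_sum bX) lee_fin -(subnKC mn).
apply: expect_threshold_le => //.
  move=> i j /subnKC <-; elim: (j - i)%N => [|l IHl]; first by rewrite addn0.
  by rewrite addnS; apply: le_trans IHl.
have nd : nondecreasing_seq (series c) by apply: nondecreasing_series => i _ _.
have cv : cvgn (series c) by apply/cvg_ex; exists 1.
by rewrite -(cvg_lim _ c1) //; apply: nondecreasing_cvgn_le nd cv _.
Qed.

Theorem theorem19 (R : realType) (d : measure_display) (T : measurableType d)
  (P : probability T R) (X : nat -> T -> R) (p t : R) (k : nat) :
  (0 < k)%N -> bernoulli_seq P X p ->
  0 <= p -> p < (2 * k + 1)%:R^-1 ->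
  (k + 1)%:R^-1 < t -> t <= 1 -> p <= t ->
  pi_opt P X t = (1 - (1 - p) ^ (Num.floor t^-1))%:E.
Proof.
move=> k0 bX p0 pk kt t1 _.
have t0 : 0 < t by apply: lt_trans kt; rewrite invr_gt0 ltr0n addn1.
have floor_ge1 : 1 <= Num.floor t^-1 by rewrite floor_ge_int invf_ge1.
pose m := `|Num.floor t^-1|%N.
have floorE : Num.floor t^-1 = m by rewrite gez0_abs // (le_trans _ floor_ge1).
have m0 : (0 < m)%N by rewrite -ltz_nat -floorE.
have /andP[] := floor_itv t^-1; rewrite floorE -/m => m_le m_gt.
have tm : t <= m%:R^-1 by rewrite -[t]invrK lef_pV2 // posrE ?invr_gt0 // ltr0n.
have mt : 1 < m.+1%:R * t.
  by rewrite -ltr_pdivrMr // mul1r -addn1.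
(* From [m <= 1 / t < k + 1]; this turns the bound on [p] in terms of [k] into the one for [m]. *)
have mk : (m <= k)%N.
  rewrite -ltnS -(ltr_nat R) (le_lt_trans m_le) // -[k.+1%:R]invrK.
  by rewrite ltf_pV2 ?posrE ?invr_gt0 ?ltr0n // -addn1.
have k1 : 0 < (2 * k + 1)%:R :> R by rewrite ltr0n addn1.
have kp : (2 * k + 1)%:R * p < 1 by rewrite -ltr_pdivlMl // mulr1.
have mp : (2 * m + 1)%:R * p <= 1.
  by apply: le_trans (ltW kp); apply: ler_wpM2r => //; rewrite ler_nat; lia.
have p1 : p < 1.
  by apply: lt_le_trans pk _; rewrite invf_le1 // ler1n addn1.
rewrite -exprnP; apply/eqP; rewrite eq_le; apply/andP; split.
  by apply: ge_ereal_sup => _ /= [c cs <-]; exact: prob_stake_sum_bound.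
apply: le_trans (prob_bold_play_ge bX m0 tm) _; apply: ereal_sup_ubound.
by exists (bold_play m) => //; exact: bold_play_stake_seq.
Qed.
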